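(* Let $k$ be an algebraically closed field of characteristic zero and let $G$ be a finite group. The map $$\mathcal{B}(G)\to \operatorname{colim}_{A}\, H^2(\widehat A,k^\times)^G$$ that sends $(A,b)$ to $[A,b]$ is a bijection of sets, where the colimit is taken, in the category of sets, over the category of abelian normal subgroups $A$ of $G$ with inclusions as arrows.
   Context: For a finite abelian group $A$ let $\widehat A=\mathrm{Hom}(A,k^\times)$. The group $H^2(\widehat A,k^\times)$ (trivial action on $k^\times$) is identified with the group of alternating bilinear forms $b:\widehat A\times\widehat A\to k^\times$ (alternating: $b(\chi,\chi)=1$ for all $\chi$), the class of a two-cocycle $c$ corresponding to $b(\rho,\sigma)=c(\sigma,\rho)/c(\rho,\sigma)$. For $A$ normal in $G$, the group $G$ acts on $A$ by conjugation, hence on $\widehat A$ and on $H^2(\widehat A,k^\times)$; $H^2(\widehat A,k^\times)^G$ denotes the invariants (equivalently, $G$-invariant alternating forms). For an inclusion $A\subset B$ of abelian normal subgroups, the map $H^2(\widehat A,k^\times)^G\to H^2(\widehat B,k^\times)^G$ is the one induced by the restriction map $\widehat B\to\widehat A$. For $b\in H^2(\widehat A,k^\times)^G$, $[A,b]$ denotes the corresponding element of the colimit. $\mathcal{B}(G)$ is the set of pairs $(A,b)$ where $A$ is an abelian normal subgroup of $G$ and $b:\widehat A\times\widehat A\to k^\times$ is a $G$-invariant non-degenerate alternating bilinear form. *)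

(* Defs.v *)
From HB Require Import structures.
From Stdlib Require Import Relation_Operators.
From mathcomp Require Import all_boot all_fingroup all_algebra.
From mathcomp Require Import boolp.

Set Implicit Arguments.
Unset Strict Implicit.
Unset Printing Implicit Defensive.

Import GRing.Theory.
Local Open Scope ring_scope.
Local Open Scope quotient_scope.

(* Quotient of T by the equivalence relation generated by R. *)
Section GeneratedQuotient.
Variables (T : Type) (R : T -> T -> Prop).

Definition gen_rel : rel {classic T} :=
  fun x y => `[< clos_refl_sym_trans T R x y >].

Lemma gen_rel_equiv : equiv_class_of gen_rel.
Proof.
split=> [x|x y|y x z].
- by apply/asboolP; apply: rst_refl.
- by apply/asboolP/asboolP; apply: rst_sym.
- by move=> /asboolP xy /asboolP yz; apply/asboolP; apply: rst_trans xy yz.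
Qed.

Canonical gen_equiv_rel := EquivRelPack gen_rel_equiv.

Definition quot : Type := {eq_quot gen_rel}.
Definition cls (x : T) : quot := \pi_({eq_quot gen_rel}) (x : {classic T}).
Definition rep (q : quot) : T := generic_quotient.repr (q : {eq_quot gen_rel}).

Lemma repK q : cls (rep q) = q.
Proof. exact: (@reprK _ {eq_quot gen_rel}). Qed.

Lemma clsP x y : cls x = cls y <-> clos_refl_sym_trans T R x y.
Proof.
split; first by move/eqmodP/asboolP.
by move=> xy; apply/eqmodP/asboolP.
Qed.

Lemma rep_cls (S : Type) (f : T -> S) :
  (forall x y, R x y -> f x = f y) -> forall x, f (rep (cls x)) = f x.
Proof.
move=> fR x; have /clsP := repK (cls x).
suff e y z : clos_refl_sym_trans T R y z -> f y = f z by exact: e.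
by elim=> [{}y {}z /fR | | {}y {}z _ -> | {}y {}z t _ -> _ ->].
Qed.
End GeneratedQuotient.

(* H^2(M, k^x) with trivial action; cochains are functions M -> M -> k with   *)
(* nonzero values.                                                            *)
Section H2.
Variable k : fieldType.

Definition is_cocycle (M : groupType) (c : M -> M -> k) : Prop :=
  (forall r s, c r s != 0) /\
  (forall r s t, c s t * c r (s * t)%g = c (r * s)%g t * c r s).

Definition cocycle (M : groupType) := {c : M -> M -> k | is_cocycle c}.

Definition cohomologous (M : groupType) (c c' : cocycle M) : Prop :=
  exists2 f : M -> k, forall r, f r != 0 &
    forall r s, sval c' r s = sval c r s * (f r * f s / f (r * s)%g).

(* cohomologous is already an equivalence relation, so the closure taken by   *)
(* quot adds nothing.                                                         *)
Definition H2 (M : groupType) : Type := quot (@cohomologous M).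

Section Pullback.
Variables (M N : groupType) (phi : {multiplicative M -> N}).

Lemma pull_cocycle_subproof (c : cocycle N) :
  is_cocycle (fun r s : M => sval c (phi r) (phi s)).
Proof.
case: c => c [c0 cM] /=; split=> [r s|r s t]; first exact: c0.
by rewrite !gmulfM cM.
Qed.

Definition pull_cocycle (c : cocycle N) : cocycle M :=
  exist _ _ (pull_cocycle_subproof c).

Definition H2map (h : H2 N) : H2 M := cls _ (pull_cocycle (rep h)).

Lemma H2map_cls c : H2map (cls _ c) = cls _ (pull_cocycle c).
Proof.
rewrite /H2map.
apply: (rep_cls (f := fun c => cls (@cohomologous M) (pull_cocycle c))).
move=> {}c c' [f f0 cc']; apply/clsP/rst_step.
by exists (fun r => f (phi r)) => //= r s; rewrite cc' gmulfM.
Qed.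
End Pullback.

(* The form b(r, s) = c(s, r) / c(r, s) attached to the class of c.           *)
Definition H2form (M : groupType) (h : H2 M) (r s : M) : k :=
  sval (rep h) s r / sval (rep h) r s.

(* For commutative M the form does not depend on the representative. *)
Lemma H2form_cls (M : groupType) : commutative (@mulg M) ->
  forall (c : cocycle M) r s, H2form (cls _ c) r s = sval c s r / sval c r s.
Proof.
move=> mulC c r s; rewrite /H2form.
apply: (rep_cls (f := fun c : cocycle M => sval c s r / sval c r s)).
move=> {}c c' [f f0 cc']; rewrite !cc' (mulC s r) (mulrC (f s)).
by rewrite -mulf_div divff ?mulr1 // !mulf_neq0 ?invr_eq0.
Qed.

End H2.

(* The character group Hom(H, k^x). *)
Section Dual.
Variable k : fieldType.

Section Def.
Variable H : finGroupType.

Definition is_character (chi : {ffun H -> k}) : bool :=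
  [forall x, chi x != 0] &&
  [forall x, forall y, chi (x * y)%g == chi x * chi y].

Record dual := Dual { dual_fun :> {ffun H -> k}; _ : is_character dual_fun }.
HB.instance Definition _ := [isSub for dual_fun].
HB.instance Definition _ := [Choice of dual by <:].

Lemma characterP (chi : {ffun H -> k}) :
  reflect ((forall x, chi x != 0) /\
           (forall x y, chi (x * y)%g = chi x * chi y))
          (is_character chi).
Proof.
apply: (iffP andP) => -[c0 cM]; split; first exact/forallP.
- by move=> x y; apply/eqP; move/forallP/(_ x)/forallP: cM; apply.
- exact/forallP.
- by apply/forallP => x; apply/forallP => y; rewrite cM.
Qed.

Lemma dual_neq0 (chi : dual) x : chi x != 0.
Proof. by case: chi => chi /= /characterP[]. Qed.

Lemma dualM (chi : dual) x y : chi (x * y)%g = chi x * chi y.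
Proof. by case: chi => chi /= /characterP[]. Qed.

Lemma dual_eqP (chi psi : dual) : (forall x, chi x = psi x) -> chi = psi.
Proof. by move=> e; apply/val_inj/ffunP. Qed.

Lemma dual_one_subproof : is_character [ffun _ : H => 1].
Proof.
by apply/characterP; split=> [x|x y]; rewrite !ffunE ?oner_eq0 ?mulr1.
Qed.
Definition dual_one := Dual dual_one_subproof.

Lemma dual_mul_subproof (chi psi : dual) :
  is_character [ffun x => chi x * psi x].
Proof.
apply/characterP; split=> [x|x y]; rewrite !ffunE.
  by rewrite mulf_neq0 ?dual_neq0.
by rewrite !dualM mulrACA.
Qed.
Definition dual_mul chi psi := Dual (dual_mul_subproof chi psi).

Lemma dual_inv_subproof (chi : dual) : is_character [ffun x => (chi x)^-1].
Proof.
apply/characterP; split=> [x|x y]; rewrite !ffunE.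
  by rewrite invr_eq0 dual_neq0.
by rewrite dualM invfM.
Qed.
Definition dual_inv chi := Dual (dual_inv_subproof chi).

Lemma dual_mulA : associative dual_mul.
Proof. by move=> a b c; apply: dual_eqP => x; rewrite !ffunE mulrA. Qed.
Lemma dual_mul1 : left_id dual_one dual_mul.
Proof. by move=> a; apply: dual_eqP => x; rewrite !ffunE mul1r. Qed.
Lemma dual_mulr1 : right_id dual_one dual_mul.
Proof. by move=> a; apply: dual_eqP => x; rewrite !ffunE mulr1. Qed.
Lemma dual_mulV : left_inverse dual_one dual_inv dual_mul.
Proof.
by move=> a; apply: dual_eqP => x; rewrite !ffunE mulVf ?dual_neq0.
Qed.
Lemma dual_mulrV : right_inverse dual_one dual_inv dual_mul.
Proof.
by move=> a; apply: dual_eqP => x; rewrite !ffunE mulfV ?dual_neq0.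
Qed.

HB.instance Definition _ := isGroup.Build dual
  dual_mulA dual_mul1 dual_mulr1 dual_mulV dual_mulrV.

Lemma dual_mulgC : commutative (@mulg dual).
Proof. by move=> a b; apply: dual_eqP => x; rewrite !ffunE mulrC. Qed.
End Def.

Section Map.
Variables (H K : finGroupType) (f : {multiplicative H -> K}).

Lemma dual_map_subproof (chi : dual K) : is_character [ffun x => chi (f x)].
Proof.
apply/characterP; split=> [x|x y]; rewrite !ffunE ?dual_neq0 //.
by rewrite gmulfM dualM.
Qed.
Definition dual_map (chi : dual K) : dual H := Dual (dual_map_subproof chi).

Lemma dual_map_mul : {morph dual_map : chi psi / (chi * psi)%g}.
Proof. by move=> a b; apply: dual_eqP => x; rewrite !ffunE. Qed.
HB.instance Definition _ :=
  isMultiplicative.Build (dual K) (dual H) dual_map dual_map_mul.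
End Map.
End Dual.

Section AbelianNormal.
Variable G : finGroupType.

Record abnormal := AbNormal {
  abn_group :> {group G};
  _ : (abn_group <| [set: G])%g && abelian abn_group }.
HB.instance Definition _ := [isSub for abn_group].
HB.instance Definition _ := [Choice of abnormal by <:].

Section Inclusion.
Variables (A B : {group G}) (sAB : A \subset B).
Definition subg_incl (x : subg_of A) : subg_of B :=
  Subg (subsetP sAB _ (subgP x)).
Lemma subg_inclM : {morph subg_incl : x y / (x * y)%g}.
Proof. by move=> x y; apply: val_inj. Qed.
HB.instance Definition _ :=
  isMultiplicative.Build (subg_of A) (subg_of B) subg_incl subg_inclM.
End Inclusion.

Section Conjugation.
Variables (A : abnormal) (g : G).
Lemma abn_conj_subproof (x : subg_of A) : (sgval x ^ g)%g \in A.
Proof.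
case: A x => B /= /andP[/andP[_ /subsetP nB] _] x.
by rewrite memJ_norm ?subgP ?nB ?inE.
Qed.
Definition abn_conj (x : subg_of A) : subg_of A := Subg (abn_conj_subproof x).
Lemma abn_conjM : {morph abn_conj : x y / (x * y)%g}.
Proof. by move=> x y; apply: val_inj; rewrite /= conjMg. Qed.
HB.instance Definition _ :=
  isMultiplicative.Build (subg_of A) (subg_of A) abn_conj abn_conjM.
End Conjugation.
End AbelianNormal.

Arguments abn_conj {G} A g x.
Arguments subg_incl {G A B} sAB x.

Section Colimit.
Variables (k : fieldType) (G : finGroupType).

Definition hat (A : {group G}) : groupType := dual k (subg_of A).

(* (g . chi)(a) = chi (g^-1 a g) *)
Definition hat_act (A : abnormal G) (g : G) : {multiplicative hat A -> hat A} :=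
  dual_map (abn_conj A g).

Definition hat_res (A B : {group G}) (sAB : A \subset B) :
  {multiplicative hat B -> hat A} := dual_map (subg_incl sAB).

(* H2map (hat_act A g) is the action of g^-1 on H^2. *)
Definition H2inv (A : abnormal G) : Type :=
  {h : H2 k (hat A) | forall g : G, H2map (hat_act A g) h = h}.

Lemma H2inv_map_subproof (A B : abnormal G) (sAB : A \subset B) (h : H2inv A) :
  forall g : G, H2map (hat_act B g) (H2map (hat_res sAB) (sval h))
                = H2map (hat_res sAB) (sval h).
Proof.
case: h => h hinv g /=; rewrite -{2}(hinv g) -(repK h) !H2map_cls.
congr (cls _ _); apply: eq_exist => /=.
apply/funext => r; apply/funext => s.
have e (x : hat B) : hat_res sAB (hat_act B g x) = hat_act A g (hat_res sAB x).
  by apply: dual_eqP => a; rewrite !ffunE; congr (x _); apply: val_inj.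
by rewrite !e.
Qed.

Definition H2inv_map (A B : abnormal G) (sAB : A \subset B) (h : H2inv A) :
  H2inv B := exist _ _ (H2inv_map_subproof sAB h).

Definition colim_arrow (x y : {A : abnormal G & H2inv A}) : Prop :=
  exists sAB : tag x \subset tag y, H2inv_map sAB (tagged x) = tagged y.

(* Colimit in Set: the disjoint union modulo the relation generated by the    *)
(* arrows of the diagram.                                                     *)
Definition colimH2 : Type := quot colim_arrow.

Definition colim_in (A : abnormal G) (h : H2inv A) : colimH2 :=
  cls colim_arrow (Tagged H2inv h).

Definition alternating_form (A : {group G}) (b : hat A -> hat A -> k) : Prop :=
  [/\ forall r s, b r s != 0,
      forall r r' s, b (r * r')%g s = b r s * b r' s,
      forall r s s', b r (s * s')%g = b r s * b r s'
    & forall r, b r r = 1].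

Definition nondegenerate (A : {group G}) (b : hat A -> hat A -> k) : Prop :=
  forall r, (forall s, b r s = 1) -> r = 1%g.

Definition invariant_form (A : abnormal G) (b : hat A -> hat A -> k) : Prop :=
  forall (g : G) r s, b (hat_act A g r) (hat_act A g s) = b r s.

(* The set B(G) of pairs (A, b). *)
Record calB := CalB {
  calB_group : abnormal G;
  calB_form : hat calB_group -> hat calB_group -> k;
  _ : alternating_form calB_form;
  _ : nondegenerate calB_form;
  _ : invariant_form calB_form }.

End Colimit.

Arguments calB_group {k G} p : rename.
Arguments calB_form {k G} p r s : rename.

(* Main.v *)
(* An invariant alternating form b on the dual of A has a G-stable radical R.
   By duality R is the kernel of the restriction to the dual of the annihilator
   B of R in A, a normal subgroup of G, so b descends to an invariant
   non-degenerate form on the dual of B. The pair (B, reduced form) is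
   determined by (A, b) and does not change when b is inflated to a larger
   abelian normal subgroup; hence it is an invariant of the class of (A, b) in
   the colimit, and it provides the inverse map.

   Both the injectivity of H^2 -> {alternating forms} and the duality rest on
   one fact: for a symmetric cocycle c the operators of the twisted regular
   representation are simultaneously diagonalizable, so c-twisted characters
   exist and separate the elements of the twisted group algebra. *)

Require Import Defs.
From mathcomp Require Import all_boot all_fingroup all_algebra.
From HB Require Import structures.
From Stdlib Require Import Relation_Operators.
From mathcomp Require Import cyclic abelian separable boolp ring.

Set Implicit Arguments.
Unset Strict Implicit.
Unset Printing Implicit Defensive.

Import GRing.Theory.
Local Open Scope ring_scope.

(** * Twisted characters of a symmetric cocycle *)

Section CharacteristicZero.
Variables (k : closedFieldType) (char0 : [pchar k] =i pred0).

Lemma natf_neq0_char0 m : (0 < m)%N -> m%:R != 0 :> k.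
Proof. by rewrite ((pcharf0P k).1 char0) lt0n. Qed.

(** In characteristic zero X^m - a is prime to its derivative, so the minimal polynomial of [A],
    which divides it, has simple roots. *)
Lemma diagonalizable_root_scalar n (A : 'M[k]_n.+1) m a :
  (0 < m)%N -> a != 0 -> A ^+ m = a%:M ->
  exists2 P : 'M_n.+1, P \in unitmx & similar_diag P A.
Proof.
move=> m_gt0 a_neq0 Am; apply/diagonalizableP.
pose p : {poly k} := 'X^m - a%:P; have [rs Dp] := closed_field_poly_normal p.
have p_monic : p \is monic by rewrite monicXnsubC.
rewrite (monicP p_monic) scale1r in Dp; exists rs.
  rewrite -separable_prod_XsubC -Dp unlock linearB /= derivC subr0 derivXn.
  rewrite -scaler_nat coprimepZr ?natf_neq0_char0 //.
  rewrite /p -{1}(prednK m_gt0) exprS -polyCN coprimep_sym coprimep_addl_mul.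
  by rewrite -alg_polyC coprimepZr ?coprimep1 // oppr_eq0.
rewrite -Dp; apply: mxminpoly_min; rewrite rmorphB rmorphXn /= horner_mx_X.
by rewrite horner_mx_C Am subrr.
Qed.

Section TwistedCharacters.
Variables (M : finGroupType) (mulC : commutative (@mulg M)).
Variables (c : M -> M -> k) (c_cocycle : is_cocycle c).
Hypothesis c_sym : forall r s, c r s = c s r.

(** The [U r] commute and each has a scalar power, so they are simultaneously diagonalizable. Every
    diagonal position carries a twisted character, and the weighted sum, nonzero and diagonal in
    that basis, has a nonzero diagonal entry. *)
Lemma twisted_character_mx n (U : M -> 'M[k]_n.+1) (w : M -> k) (a : k) :
    a != 0 -> U 1%g = a%:M ->
    (forall r s, U r * U s = c r s *: U (r * s)%g) ->
    \sum_r w r *: U r != 0 ->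
  exists2 f : M -> k,
    (forall r, f r != 0) /\ (forall r s, f r * f s = c r s * f (r * s)%g) &
    \sum_r w r * f r != 0.
Proof.
move=> a_neq0 U1 UM wU_neq0; have [c_neq0 _] := c_cocycle.
have Upow r i : exists2 l, l != 0 & U r ^+ i = l *: U (r ^+ i)%g.
  elim: i => [|i [l l_neq0 IHi]].
    exists a^-1; first by rewrite invr_eq0.
    by rewrite expr0 expg0 U1 -scalemx1 scalerA mulVf // scale1r.
  exists (l * c r (r ^+ i)%g); first by rewrite mulf_neq0.
  by rewrite exprS IHi -scalerAr UM scalerA expgS.
have Udiag r : exists2 P : 'M_n.+1, P \in unitmx & similar_diag P (U r).
  have [l l_neq0 Ul] := Upow r #[r]%g.
  apply: (@diagonalizable_root_scalar _ _ #[r]%g (l * a)).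
  - exact: order_gt0.
  - by rewrite mulf_neq0.
  - by rewrite Ul expg_order U1 scale_scalar_mx.
have [P uP Pdiag] : exists2 P : 'M_n.+1, P \in unitmx &
    all [pred A | similar_diag P A] [seq U r | r <- enum M].
  apply/codiagonalizableP.
  split=> [_ _ /mapP[r _ ->] /mapP[s _ ->]|_ /mapP[r _ ->] //].
  by rewrite /comm_mx -[_ *m _]/(_ * _) -[X in _ = X]/(_ * _) !UM c_sym mulC.
pose D r := P *m U r *m invmx P.
have Ddiag r (i j : 'I_n.+1) : i != j -> D r i j = 0.
  have /similar_diagP := allP Pdiag (U r) (map_f U (mem_enum M r)).
  by move/(_ uP i j).
have DM r s : D r *m D s = c r s *: D (r * s)%g.
  rewrite /D !mulmxA mulmxKV // -(mulmxA P) -[U r *m U s]/(U r * U s) UM.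
  by rewrite -scalemxAr -scalemxAl.
have DwE i j : (P *m (\sum_r w r *: U r) *m invmx P) i j = \sum_r w r * D r i j.
  rewrite mulmx_sumr mulmx_suml summxE; apply: eq_bigr => r _.
  by rewrite -scalemxAr -scalemxAl mxE.
have DiM i r s : D r i i * D s i i = c r s * D (r * s)%g i i.
  have := congr1 (fun A : 'M_n.+1 => A i i) (DM r s).
  rewrite mxE [RHS]mxE (bigD1 i) //= big1 ?addr0 // => j ji.
  by rewrite Ddiag ?mul0r // eq_sym.
have D1 i : D 1%g i i = a.
  by rewrite /D U1 scalar_mxC -mulmxA mulmxV // mulmx1 mxE eqxx mulr1n.
have [i wDi] : exists i, \sum_r w r * D r i i != 0.
  apply/existsP; apply: contraNT wU_neq0 => /existsPn wD0.
  have : P *m (\sum_r w r *: U r) *m invmx P = 0.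
    apply/matrixP => i j; rewrite DwE mxE.
    have [<-|ij] := eqVneq i j; first exact/eqP/negPn/wD0.
    by rewrite big1 // => r _; rewrite Ddiag ?mulr0.
  move/(congr1 (mulmxr P)); rewrite /= mulmxKV // mul0mx.
  by move/(congr1 (mulmx (invmx P))); rewrite mulmx0 mulKmx // => /eqP.
(* No value vanishes, since those at r and r^-1 multiply to [c r r^-1 * a]. *)
exists (fun r => D r i i) => //; split=> // r; apply/eqP => Dr0.
have := DiM i r r^-1%g; rewrite Dr0 mul0r mulgV D1 => /esym/eqP.
by rewrite mulf_eq0 (negPf a_neq0) orbF (negPf (c_neq0 _ _)).
Qed.

(** The twisted regular representation is faithful: in row 1 and column [x], the weighted sum has
    the entry [w x * c x 1]. *)
Lemma twisted_character (w : M -> k) x : w x != 0 ->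
  exists2 f : M -> k,
    (forall r, f r != 0) /\ (forall r s, f r * f s = c r s * f (r * s)%g) &
    \sum_r w r * f r != 0.
Proof.
move=> wx_neq0; have [c_neq0 cM] := c_cocycle.
have cardM : #|M| = #|M|.-1.+1 by rewrite prednK //; apply/card_gt0P; exists x.
pose e (i : 'I_#|M|.-1.+1) : M := enum_val (cast_ord (esym cardM) i).
pose e' y := cast_ord cardM (enum_rank y).
have e'K : cancel e' e by move=> y; rewrite /e cast_ordK enum_rankK.
have eK : cancel e e' by move=> y; rewrite /e' enum_valK cast_ordKV.
(* the twisted regular representation *)
pose U r : 'M[k]_#|M|.-1.+1 :=
  \matrix_(i, j) (c r (e i) * (e j == r * e i)%g%:R).
(* A cocycle need not be normalized: [U 1] is the scalar [c 1 1]. *)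
have c1 y : c 1%g y = c 1%g 1%g.
  by apply: (mulfI (c_neq0 1%g y)); have := cM 1%g 1%g y; rewrite !mul1g.
apply: (@twisted_character_mx _ U w (c 1%g 1%g)) => //.
- apply/matrixP => i j; rewrite !mxE mul1g c1 (can_eq eK) eq_sym.
  by rewrite mulr_natr.
(* Row vectors meet [U r] first, so the cocycle identity yields s * r; commutativity and symmetry
   turn it into r * s. *)
- move=> r s; apply/matrixP => i l; rewrite !mxE (bigD1 (e' (r * e i)%g)) //=.
  rewrite big1 => [|j je]; rewrite !mxE.
    rewrite addr0 e'K eqxx mulr1 mulrA cM mulgA (mulC s r) (c_sym s r).
    by rewrite mulrA [_ * c r s]mulrC.
  by rewrite -(can2_eq eK e'K) in je; rewrite (negPf je) mulr0 mul0r.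
- apply: contraNneq wx_neq0 => /matrixP/(_ (e' 1%g) (e' x)).
  rewrite summxE mxE (bigD1 x) //= big1 => [|y yx]; rewrite !mxE !e'K mulg1.
    rewrite eqxx mulr1 addr0 => /eqP.
    by rewrite mulf_eq0 (negPf (c_neq0 _ _)) orbF.
  by rewrite eq_sym (negPf yx) !mulr0.
Qed.

End TwistedCharacters.

End CharacteristicZero.

(** * Finiteness of the character group *)

Section FiniteDual.
Variables (k : closedFieldType) (H : finGroupType).

Lemma dual1 (chi : dual k H) : chi 1%g = 1.
Proof.
by apply: (mulfI (dual_neq0 chi 1%g)); rewrite -dualM mulg1 mulr1.
Qed.

Lemma dual_card_root (chi : dual k H) x : chi x ^+ #|H| = 1.
Proof.
have chiX m : chi (x ^+ m)%g = chi x ^+ m.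
  by elim: m => [|m IHm]; rewrite ?dual1 // expgS dualM IHm exprS.
by rewrite -chiX -cardsT expg_cardG ?inE ?dual1.
Qed.

(** Character values are roots of unity of order dividing [#|H|]; this finite list of candidates
    makes [dual k H] a finite type. *)
Definition dual_values : seq k :=
  sval (closed_field_poly_normal ('X^#|H| - 1 : {poly k})).

Lemma mem_dual_values (chi : dual k H) x : chi x \in dual_values.
Proof.
rewrite /dual_values; case: closed_field_poly_normal => rs /= Dp.
have n_gt0 : (0 < #|H|)%N by apply/card_gt0P; exists x.
have /monicP m1 : ('X^#|H| - 1 : {poly k}) \is monic by rewrite monicXnsubC.
rewrite m1 scale1r in Dp.
by rewrite -root_prod_XsubC -Dp rootE !hornerE dual_card_root subrr.
Qed.

(** The successor in the codomain serves [inord]; the index of a character value never reaches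
    it. *)
Definition dual_code (chi : dual k H) : {ffun H -> 'I_(size dual_values).+1} :=
  [ffun x => inord (index (chi x) dual_values)].

Definition dual_decode (t : {ffun H -> 'I_(size dual_values).+1}) :
    option (dual k H) :=
  insub [ffun x => dual_values`_(t x)].

Lemma dual_codeK : pcancel dual_code dual_decode.
Proof.
move=> chi; rewrite /dual_decode -[RHS](valK chi); congr (insub _).
apply/ffunP => x; rewrite !ffunE inordK ?nth_index ?mem_dual_values //.
by rewrite ltnS index_size.
Qed.

HB.instance Definition _ := PCanIsCountable dual_codeK.
HB.instance Definition _ : isFinite (dual k H) := PCanIsFinite dual_codeK.

End FiniteDual.

(** * Orthogonality of characters and duality *)

Section Duality.
Variables (k : closedFieldType) (char0 : [pchar k] =i pred0).

(** Translating the variable by y multiplies the sum by [chi y]. *)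
Lemma sum_dual_eq1 (H : finGroupType) (chi : dual k H) :
  \sum_x chi x != 0 -> chi = 1%g.
Proof.
move=> chi_neq0; apply: dual_eqP => y; rewrite ffunE.
apply: (mulIf chi_neq0); rewrite mul1r mulr_sumr [RHS](reindex_inj (mulgI y)).
by apply: eq_bigr => x _; rewrite dualM.
Qed.

(* Orthogonality of characters: the sum of the elements of R is supported on  *)
(* their common kernel, so multiplying it by r changes nothing, although it   *)
(* moves the characters in R to those in r R.                                 *)
Lemma dual_biorthogonal (H : finGroupType) (R : {group dual k H})
    (r : dual k H) :
  (forall x, (forall chi : dual k H, chi \in R -> chi x = 1) -> r x = 1) ->
  r \in R.
Proof.
move=> r_perp; apply/negPn/negP => rNR.
have sum0 (x : H) : \sum_(chi in R) r x * (chi : dual k H) x =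
                    \sum_(chi in R) (chi : dual k H) x.
  rewrite -mulr_sumr.
  have [->|F_neq0] := eqVneq (\sum_(chi in R) (chi : dual k H) x) 0.
    by rewrite mulr0.
  rewrite r_perp ?mul1r // => psi Rpsi.
  apply: (mulIf F_neq0); rewrite mul1r mulr_sumr [RHS](reindex_inj (mulgI psi)).
  by apply: eq_big => chi; rewrite ?groupMl // ?ffunE.
have orth (s : dual k H) : s != 1%g -> \sum_x s x = 0.
  by move=> s1; apply/eqP; apply: contraNT s1 => /sum_dual_eq1 ->.
(* Evaluate this sum twice. Cancelling r leaves only the trivial character; using [sum0] first
   leaves the characters r^-1 chi, all nontrivial since r is outside [R], and gives 0. *)
have : \sum_x (r^-1%g : dual k H) x *
         \sum_(chi in R) r x * (chi : dual k H) x = #|H|%:R.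
  under eq_bigr do rewrite mulr_sumr; rewrite exchange_big (bigD1 1%g) //=.
  rewrite [X in _ + X]big1 => [|chi /andP[_ chi1]].
    rewrite addr0 -sum1_card natr_sum; apply: eq_bigr => x _.
    by rewrite !ffunE mulr1 mulVf // dual_neq0.
  apply: etrans (orth chi chi1); apply: eq_bigr => x _.
  by rewrite ffunE mulKf // dual_neq0.
under eq_bigr do rewrite sum0 mulr_sumr; rewrite exchange_big /= big1.
  move/eqP; rewrite eq_sym (negPf (natf_neq0_char0 char0 _)) //.
  by apply/card_gt0P; exists 1%g.
move=> chi Rchi; apply: etrans (orth (r^-1 * chi)%g _).
  by apply: eq_bigr => x _; rewrite !ffunE.
by apply: contraNneq rNR => rchi; rewrite -(mulg1 r) -rchi mulKVg.
Qed.

(** A nonzero function has a nonzero Fourier coefficient: characters twisted by the cocycle 1 are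
    ordinary characters. *)
Lemma exists_dual (K : finGroupType) (w : K -> k) x :
  commutative (@mulg K) -> w x != 0 ->
  exists chi : dual k K, \sum_y w y * chi y != 0.
Proof.
move=> mulC wx.
have cocycle1 : is_cocycle (fun _ _ : K => 1 : k).
  by split=> *; rewrite ?oner_eq0.
have [f [f0 fM] wf] :=
  twisted_character char0 mulC cocycle1 (fun _ _ => erefl) wx.
have f_char : is_character [ffun y => f y].
  by apply/characterP; split=> [y|y z]; rewrite !ffunE // fM mul1r.
by exists (Dual f_char); under eq_bigr do rewrite /= ffunE.
Qed.

Lemma sum_fiber (I J : finType) (h : I -> J) (u : I -> k) (v : J -> k) :
  \sum_y (\sum_(a | h a == y) u a) * v y = \sum_a u a * v (h a).
Proof.
rewrite [RHS](partition_big h predT) //=; apply: eq_bigr => y _.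
by rewrite mulr_suml; apply: eq_bigr => a /eqP <-.
Qed.

Section Restriction.
Variables (H K : finGroupType) (f : {multiplicative H -> K}).
Hypotheses (f_inj : injective f) (mulC : commutative (@mulg K)).

(** Push chi^-1 forward along [f]. A nonzero Fourier coefficient of the result, at psi, is the sum
    over [H] of chi^-1 (psi o f), which forces this character to be trivial. *)
Lemma dual_map_surj (chi : dual k H) : exists psi, dual_map f psi = chi.
Proof.
pose w y := \sum_(a | f a == y) (chi a)^-1.
have w1 : w (f 1%g) != 0.
  rewrite /w (big_pred1 1%g) => [|a /=]; last by rewrite (inj_eq f_inj).
  by rewrite invr_eq0 dual_neq0.
have [psi] := exists_dual mulC w1; rewrite sum_fiber => psi_neq0; exists psi.
suff : (chi^-1 * dual_map f psi = 1)%g.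
  by move/(congr1 (mulg chi)); rewrite mulKVg mulg1.
apply: sum_dual_eq1; rewrite (eq_bigr (fun a => (chi a)^-1 * psi (f a))) //.
by move=> a _; rewrite !ffunE.
Qed.

(** A nonzero Fourier coefficient of [w] at psi factors as (psi y - 1) times the sum of psi o f;
    each factor gives one of the two conclusions. *)
Lemma dual_separates y : (forall a, f a != y) ->
  exists2 psi : dual k K, dual_map f psi = 1%g & psi y != 1.
Proof.
move=> yNf.
(* The function w is the indicator of y f(H) minus that of f(H). *)
pose w z := \sum_(a | (y * f a)%g == z) 1 - \sum_(a | f a == z) 1 : k.
have w1 : w (f 1%g) != 0.
  rewrite /w big_pred0 => [|a].
    rewrite (big_pred1 1%g) => [|a /=]; last by rewrite (inj_eq f_inj).
    by rewrite sub0r oppr_eq0 oner_eq0.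
  apply: contraNF (yNf (a^-1)%g) => /eqP yfa.
  by rewrite -(inj_eq (mulIg (f a))) yfa -gmulfM mulVg.
have [psi] := exists_dual mulC w1.
under eq_bigr do rewrite mulrBl; rewrite sumrB !sum_fiber -sumrB => psi_neq0.
have sumE : \sum_a (1 * psi (y * f a)%g - 1 * psi (f a)) =
            (psi y - 1) * \sum_a dual_map f psi a.
  rewrite mulr_sumr; apply: eq_bigr => a _.
  by rewrite ffunE !mul1r dualM mulrBl mul1r.
rewrite sumE mulf_eq0 negb_or subr_eq0 in psi_neq0.
by case/andP: psi_neq0 => psiy /sum_dual_eq1; exists psi.
Qed.

End Restriction.
End Duality.

(** * The alternating form of a cohomology class *)

Lemma H2form_neq0 (k : fieldType) (M : groupType) (h : H2 k M) r s :
  H2form h r s != 0.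
Proof.
have [c0 _] := svalP (rep h).
by rewrite /H2form mulf_neq0 ?invr_eq0.
Qed.

Section AbelianForm.
Variables (k : fieldType) (M : groupType) (mulC : commutative (@mulg M)).

(** Combine the cocycle identities for (r, r', s), (s, r, r') and (r, s, r'); [nz] is the product of
    their terms absent from the goal. *)
Lemma H2formMl (h : H2 k M) r r' s :
  H2form h (r * r')%g s = H2form h r s * H2form h r' s.
Proof.
rewrite /H2form; move: (rep h) => [c /= [c0 cM]].
rewrite mulf_div; apply/eqP; rewrite eqr_div ?mulf_neq0 //; apply/eqP.
have nz : c r r' * c r (r' * s)%g * c (s * r)%g r' != 0 by rewrite !mulf_neq0.
have e1 := cM r r' s; have e2 := cM s r r'; have e3 := cM r s r'.
rewrite (mulC s r') (mulC r s) in e3.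
apply: (mulIf nz).
transitivity ((c r r' * c s (r * r')%g) * (c r' s * c r (r' * s)%g)
              * (c (s * r)%g r' * c r s)); first by ring.
by rewrite e1 e2 -e3; ring.
Qed.

Lemma H2formV (h : H2 k M) r s : H2form h s r = (H2form h r s)^-1.
Proof. by rewrite /H2form invf_div. Qed.

Lemma H2formMr (h : H2 k M) r s s' :
  H2form h r (s * s')%g = H2form h r s * H2form h r s'.
Proof. by rewrite H2formV H2formMl invfM -!H2formV. Qed.

Lemma H2formxx (h : H2 k M) r : H2form h r r = 1.
Proof. by rewrite /H2form divff //; case: (svalP (rep h)). Qed.

End AbelianForm.

Lemma H2form_map (k : fieldType) (M N : groupType)
    (phi : {multiplicative M -> N}) (h : H2 k N) :
  commutative (@mulg M) ->
  forall r s, H2form (H2map phi h) r s = H2form h (phi r) (phi s).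
Proof. by move=> mulC r s; rewrite /H2map H2form_cls. Qed.

(** * Classes and alternating forms on a finite abelian group *)

Section FiniteAbelian.
Variables (k : closedFieldType) (char0 : [pchar k] =i pred0).
Variables (M : finGroupType) (mulC : commutative (@mulg M)).

(** When the forms agree, the quotient [d] of the two cocycles is symmetric, and a [d]-twisted
    character is a cochain with coboundary [d]. *)
Lemma H2form_inj (h h' : H2 k M) : H2form h =2 H2form h' -> h = h'.
Proof.
move=> hh'; rewrite -(repK h) -(repK h'); apply/clsP/rst_step.
move: hh'; rewrite /H2form; move: (rep h) (rep h') => c c' cc'.
have [c0 cM] := svalP c; have [c'0 c'M] := svalP c'.
pose d r s := sval c' r s / sval c r s.
have d_cocycle : is_cocycle d.
  split=> [r s|r s t]; first by rewrite mulf_neq0 ?invr_eq0.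
  by rewrite /d !mulf_div cM c'M.
have d_sym r s : d r s = d s r.
  have /eqP := cc' r s; rewrite eqr_div // => /eqP e.
  by apply/eqP; rewrite /d eqr_div // mulrC -e mulrC.
have [f [f0 fM] _] := @twisted_character k char0 M mulC d d_cocycle d_sym
  (fun=> 1) 1%g (oner_neq0 _).
by exists f => // r s; rewrite fM mulfK // /d mulrC mulfVK.
Qed.

Section AlternatingCocycle.
Variable b : M -> M -> k.
Hypotheses (b0 : forall r s, b r s != 0) (bxx : forall r, b r r = 1).
Hypothesis bMl : forall r r' s, b (r * r')%g s = b r s * b r' s.
Hypothesis bMr : forall r s s', b r (s * s')%g = b r s * b r s'.

Lemma alternating_skew r s : b r s * b s r = 1.
Proof. by have := bxx (r * s)%g; rewrite bMl !bMr !bxx mul1r mulr1. Qed.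

Lemma alternating_cycle x : {in <[x]>%g &, forall r s, b r s = 1}.
Proof.
have b1r r : b r 1%g = 1.
  by apply: (mulfI (b0 r 1%g)); rewrite -bMr mulg1 mulr1.
have b1l r : b 1%g r = 1.
  by apply: (mulfI (b0 1%g r)); rewrite -bMl mulg1 mulr1.
have bx j : b x (x ^+ j)%g = 1.
  by elim: j => [|j IHj]; rewrite ?expg0 // expgS bMr bxx IHj mulr1.
move=> _ _ /cycleP[i ->] /cycleP[j ->].
by elim: i => [|i IHi]; rewrite ?expg0 // expgS bMl bx IHi mulr1.
Qed.

(* On a product of cyclic groups <[x_1]> \x ... \x <[x_n]> the bilinear       *)
(* cocycle c(r, s) = \prod_(i < j) b(s_i, r_j) has form b.                    *)
Lemma alternating_bilinear_cocycle (xs : seq M) (H : {group M}) :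
    \big[dprod/1%g]_(x <- xs) <[x]>%g = H ->
  exists c : M -> M -> k,
    [/\ forall r s, c r s != 0,
        {in H & &, forall r r' s, c (r * r')%g s = c r s * c r' s},
        {in H & &, forall r s s', c r (s * s')%g = c r s * c r s'}
      & {in H &, forall r s, c s r = b r s * c r s}].
Proof.
elim: xs H => [|x xs IHxs] H.
  rewrite big_nil => H1; exists (fun _ _ => 1).
  split=> [r s|r r' s _ _ _|r s s' _ _ _|r s]; rewrite ?oner_eq0 ?mulr1 //.
  by rewrite -H1 => /set1P-> /set1P->; rewrite bxx.
rewrite big_cons => defH; have [[_ K _ defK] mulxK cKx tixK] := dprodP defH.
have [c [c0 cMl cMr cb]] := IHxs K defK; rewrite defK in defH mulxK cKx tixK.
have complK : K \in [complements to <[x]> in H]%g by apply/complP.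
have nxH : (<[x]> <| H)%g by have [] := dprod_normal2 defH.
pose p r := divgr <[x]>%g K r; pose q r := remgr <[x]>%g K r.
have pM : {in H &, {morph p : r s / (r * s)%g}} := divgrM complK cKx.
have qM : {in H &, {morph q : r s / (r * s)%g}} := remgrM complK nxH.
have pX r : r \in H -> p r \in <[x]>%g by rewrite -mulxK; apply: mem_divgr.
have qK r : r \in H -> q r \in K by rewrite -mulxK; apply: mem_remgr.
have pq r : r = (p r * q r)%g by apply: divgr_eq.
clearbody p q.
(* The factor [b (p s) (q r)] collects the pairs i < j whose i is the new cyclic factor. *)
exists (fun r s => c (q r) (q s) * b (p s) (q r)).
split=> [r s|r r' s|r s s'|r s].
- by rewrite mulf_neq0.
- by move=> Hr Hr' Hs; rewrite qM // cMl ?qK // bMr mulrACA.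
- by move=> Hr Hs Hs'; rewrite qM // pM // cMr ?qK // bMl mulrACA.
move=> Hr Hs.
have -> : b r s = b (p r) (q s) * (b (q r) (p s) * b (q r) (q s)).
  have -> : b r s = b (p r * q r)%g (p s * q s)%g by rewrite -!pq.
  by rewrite bMl !bMr (alternating_cycle (pX r Hr) (pX s Hs)) mul1r.
rewrite cb ?qK // -[LHS]mulr1 -(alternating_skew (p s) (q r)).
by ring.
Qed.

(** Decompose [M] into cyclic factors; a bilinear function with nonzero values is a cocycle. *)
Lemma alternating_cocycle :
  exists c : cocycle k M, forall r s, sval c s r / sval c r s = b r s.
Proof.
have abM : abelian [set: M] by apply/centsP => x _ y _; apply: mulC.
have [xs defM _] := abelian_structure abM.
have [c [c0 cMl cMr cb]] := alternating_bilinear_cocycle defM.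
have c_cocycle : is_cocycle c.
  split=> // r s t; rewrite cMl ?cMr ?inE //; ring.
by exists (exist _ c c_cocycle) => r s /=; rewrite cb ?inE // mulfK.
Qed.

End AlternatingCocycle.
End FiniteAbelian.

(** * The non-degenerate reduction of an invariant form *)

Section AbelianNormalSubgroups.
Variables (k : closedFieldType) (char0 : [pchar k] =i pred0).
Variables (G : finGroupType).

Lemma abnormal_mulC (A : abnormal G) : commutative (@mulg (subg_of A)).
Proof.
case: A => A /= /andP[_ /centsP cAA] x y.
by apply: val_inj; apply: cAA; apply: subgP.
Qed.

Lemma hat_mulC (A : {group G}) : commutative (@mulg (hat k A)).
Proof. exact: dual_mulgC. Qed.

Lemma subg_incl_inj (A B : {group G}) (sAB : A \subset B) :
  injective (subg_incl sAB).
Proof. by move=> x y /(congr1 val) exy; apply: val_inj. Qed.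

Lemma hat_res_surj (A : {group G}) (B : abnormal G) (sAB : A \subset B)
  (r : hat k A) : exists s, hat_res k sAB s = r.
Proof.
exact: (dual_map_surj char0 (@subg_incl_inj A B sAB) (@abnormal_mulC B)).
Qed.

Lemma hat_actKV (A : abnormal G) g (s : hat k A) :
  hat_act k A g (hat_act k A g^-1%g s) = s.
Proof.
apply: dual_eqP => a; rewrite !ffunE; congr (s _).
by apply: val_inj; rewrite /= conjgK.
Qed.

Lemma hat_act_res (A B : abnormal G) (sAB : A \subset B) g (s : hat k B) :
  hat_act k A g (hat_res k sAB s) = hat_res k sAB (hat_act k B g s).
Proof.
by apply: dual_eqP => a; rewrite !ffunE; congr (s _); apply: val_inj.
Qed.

(** A relation, so that uniqueness and invariance along arrows can be proved without reference to
    the radical. *)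
Definition is_reduction (A : abnormal G) (b : hat k A -> hat k A -> k)
    (p : calB k G) : Prop :=
  exists sBA : calB_group p \subset A,
    forall r s, b r s = calB_form p (hat_res k sBA r) (hat_res k sBA s).

Section Reduction.
Variables (A : abnormal G) (b : hat k A -> hat k A -> k).
Hypotheses (b_alt : alternating_form b) (b_inv : invariant_form b).

Let b0 r s : b r s != 0. Proof. by case: b_alt. Qed.
Let bMl r r' s : b (r * r')%g s = b r s * b r' s. Proof. by case: b_alt. Qed.
Let bMr r s s' : b r (s * s')%g = b r s * b r s'. Proof. by case: b_alt. Qed.
Let bxx r : b r r = 1. Proof. by case: b_alt. Qed.

(** The type is spelled out because [hat] is packed as a [groupType] and hides the finite structure
    that sets require. *)
Definition radical : {set dual k (subg_of A)} :=
  [set r | [forall s : dual k (subg_of A), b r s == 1]].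

Lemma radicalP (r : dual k (subg_of A)) :
  reflect (forall s, b r s = 1) (r \in radical).
Proof. by rewrite inE; apply: (iffP forallP) => br s; apply/eqP. Qed.

Lemma radical_group_set : group_set radical.
Proof.
apply/group_setP; split=> [|r r' /radicalP br /radicalP br'].
  apply/radicalP => s; apply: (mulfI (b0 1%g s)).
  by rewrite -bMl mulg1 mulr1.
by apply/radicalP => s; rewrite bMl br br' mulr1.
Qed.
Canonical radical_group := Group radical_group_set.

Lemma radical_act g r : r \in radical -> hat_act k A g r \in radical.
Proof.
by move=> /radicalP br; apply/radicalP => s; rewrite -(hat_actKV g s) b_inv br.
Qed.

Definition radical_perp : {set G} :=
  [set sgval a | a : subg_of A & [forall r in radical, r a == 1]].

Lemma radical_perpP (a : subg_of A) :
  reflect (forall r : dual k (subg_of A), r \in radical -> r a = 1)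
          (sgval a \in radical_perp).
Proof.
rewrite mem_imset; last exact: val_inj.
by rewrite inE; apply: (iffP forall_inP) => ra r Rr; apply/eqP/ra.
Qed.

Lemma radical_perp_sub : radical_perp \subset A.
Proof. by apply/subsetP => _ /imsetP[a _ ->]; apply: subgP. Qed.

Lemma radical_perp_group_set : group_set radical_perp.
Proof.
apply/group_setP; split=> [|_ _ /imsetP[x + ->] /imsetP[y + ->]].
  by apply/(radical_perpP 1%g) => r _; rewrite dual1.
rewrite !inE => /forall_inP rx /forall_inP ry.
apply/(radical_perpP (x * y)%g) => r Rr.
by rewrite dualM (eqP (rx r Rr)) (eqP (ry r Rr)) mulr1.
Qed.

(** Normality holds because r (a^g) is the value at a of a G-translate of r, which stays in the
    radical. *)
Lemma radical_perp_abnormal :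
  (Group radical_perp_group_set <| [set: G])%g &&
  abelian (Group radical_perp_group_set).
Proof.
have /andP[nA abA] := valP A; apply/andP; split; last first.
  exact: abelianS radical_perp_sub abA.
rewrite /normal subsetT; apply/subsetP => g _; rewrite inE.
apply/subsetP => _ /imsetP[_ /imsetP[a + ->] ->]; rewrite inE => /forall_inP ra.
apply/(radical_perpP (abn_conj A g a)) => r Rr.
by have /eqP := ra _ (radical_act g Rr); rewrite ffunE.
Qed.

Definition reduced_group : abnormal G := AbNormal radical_perp_abnormal.

Lemma reduced_group_sub : reduced_group \subset A.
Proof. exact: radical_perp_sub. Qed.

Local Notation res := (hat_res k reduced_group_sub).

(** The double annihilator of the radical is the radical itself, by [dual_biorthogonal]. *)
Lemma hat_res_eq1 (r : hat k A) : res r = 1%g <-> forall s, b r s = 1.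
Proof.
split=> [r1 | /radicalP Rr].
  apply/radicalP; apply: (dual_biorthogonal char0 (R := radical_group)) => x.
  move=> /radical_perpP Bx.
  have := congr1 (fun t => dual_fun t (@Subg _ reduced_group _ Bx)) r1.
  by rewrite !ffunE => <-; congr (r _); apply: val_inj.
apply: dual_eqP => y; rewrite !ffunE.
exact: (elimT (radical_perpP (subg_incl reduced_group_sub y)) (subgP y)).
Qed.

(** Two characters with equal restriction differ by an element of the radical; skew-symmetry
    transfers this to the second argument. *)
Lemma form_res_eq (r r' s s' : hat k A) :
  res r = res r' -> res s = res s' -> b r s = b r' s'.
Proof.
have bl (t t' u : hat k A) : res t = res t' -> b t u = b t' u.
  move=> tt'; rewrite -[t](mulgKV t') bMl.
  suff /hat_res_eq1 -> : res (t * t'^-1)%g = 1%g by rewrite mul1r.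
  by apply: (mulIg (res t')); rewrite -gmulfM mulgKV mul1g.
have bV (t u : hat k A) : b u t = (b t u)^-1.
  apply: (mulfI (b0 t u)); rewrite mulfV //.
  by have := bxx (t * u)%g; rewrite bMl !bMr !bxx mul1r mulr1.
by move=> rr' ss'; rewrite (bl _ _ _ rr') bV (bl _ _ _ ss') -bV.
Qed.

Lemma reduction_exists : exists p : calB k G, is_reduction b p.
Proof.
(* The section [l] is an arbitrary choice of lifts, with no multiplicativity; [form_res_eq] makes up
   for this. *)
have [l lK] : exists l : hat k reduced_group -> hat k A, cancel l res.
  exists (fun r => sval (cid (hat_res_surj reduced_group_sub r))) => r.
  by case: cid.
pose b' r s := b (l r) (l s).
have b'E r s : b' (res r) (res s) = b r s by apply: form_res_eq; rewrite lK.
have b'_alt : alternating_form b'.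
  split=> [r s|r r' s|r s s'|r]; rewrite /b' ?b0 ?bxx // -1?bMl -1?bMr.
    by apply: form_res_eq; rewrite ?gmulfM !lK.
  by apply: form_res_eq; rewrite ?gmulfM !lK.
have b'_nondeg : Defs.nondegenerate b'.
  move=> r br; rewrite -(lK r); apply/hat_res_eq1 => s.
  by rewrite -b'E lK br.
have b'_inv : invariant_form b'.
  move=> g r s; rewrite -(lK r) -(lK s) !hat_act_res !b'E.
  exact: b_inv.
exists (CalB b'_alt b'_nondeg b'_inv), reduced_group_sub => r s.
exact/esym/b'E.
Qed.

End Reduction.

(** Otherwise some psi is trivial on the group of [q] but not on that of [p]. Through [q], psi lies
    in the radical of [b]; through [p], non-degeneracy makes its restriction trivial, a
    contradiction. *)
Lemma is_reduction_group_sub (A : abnormal G) (b : hat k A -> hat k A -> k)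
    (p q : calB k G) :
  is_reduction b p -> is_reduction b q -> calB_group p \subset calB_group q.
Proof.
move=> [sp bp] [sq bq]; apply/subsetP => x px; apply/negPn/negP => qNx.
pose y := subg_incl sp (Subg px).
have [|psi psi1 psiy] :=
  dual_separates char0 (f := subg_incl sq) (@subg_incl_inj _ _ sq)
    (@abnormal_mulC A) (y := y).
  move=> a; apply: contraNneq qNx => /(congr1 sgval) /= <-; exact: subgP.
case/eqP: psiy; have -> : psi y = hat_res k sp psi (Subg px) by rewrite ffunE.
suff -> : hat_res k sp psi = 1%g by rewrite ffunE.
case: p sp bp {px y} => B bB _ /= bB_nd _ sp bp; apply: bB_nd => s.
have [t <-] := hat_res_surj sp s; rewrite -bp bq.
have -> : hat_res k sq psi = 1%g by exact: psi1.
case: q sq {bq psi1 qNx} => C bC [c0 cMl _ _] /= _ _ sq.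
apply: (mulfI (c0 1%g (hat_res k sq t))).
by rewrite -cMl mulg1 mulr1.
Qed.

(** The groups contain each other, and the forms agree because restriction of characters is
    surjective. *)
Lemma is_reduction_unique (A : abnormal G) (b : hat k A -> hat k A -> k)
    (p q : calB k G) :
  is_reduction b p -> is_reduction b q -> p = q.
Proof.
move=> bp bq; have: calB_group p = calB_group q.
  apply/val_inj/val_inj/eqP; rewrite eqEsubset.
  by rewrite (is_reduction_group_sub bp bq) (is_reduction_group_sub bq bp).
case: p q bp bq => [B bB a1 n1 i1] [C bC a2 n2 i2] [/= sB bBE] [/= sC bCE] BC.
case: C / BC bC a2 n2 i2 sC bCE => bC a2 n2 i2 sC bCE.
have eBC : bC = bB.
  apply/funext => r; apply/funext => s.
  have [r' <-] := hat_res_surj sB r; have [s' <-] := hat_res_surj sB s.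
  by rewrite -bBE bCE (bool_irrelevance sC sB).
rewrite eBC in a2 n2 i2 *.
by congr CalB; apply: Prop_irrelevance.
Qed.

(** * Invariant classes and the arrows of the colimit *)

Lemma H2form_alternating (A : {group G}) (h : H2 k (hat k A)) :
  alternating_form (H2form h).
Proof.
have mulC := @hat_mulC A.
split=> [r s|r r' s|r s s'|r]; first exact: H2form_neq0.
- exact: H2formMl.
- exact: H2formMr.
- exact: H2formxx.
Qed.

Lemma H2inv_form_invariant (A : abnormal G) (h : H2inv k A) :
  invariant_form (H2form (sval h)).
Proof.
move=> g r s; rewrite -{2}(svalP h g) H2form_map //; exact: hat_mulC.
Qed.

(** Existence comes from [alternating_cocycle]; G-invariance and uniqueness both come from
    [H2form_inj]. *)
Lemma calB_class_exists (p : calB k G) : exists h : H2inv k (calB_group p),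
  unique (fun h' : H2inv k (calB_group p) => H2form (sval h') =2 calB_form p) h.
Proof.
case: p => A b b_alt b_nd b_inv /=; have [b0 bMl bMr bxx] := b_alt.
have mulC := @hat_mulC A.
have [c cb] :=
  @alternating_cocycle k (dual k (subg_of A)) mulC b b0 bxx bMl bMr.
pose h : H2 k (hat k A) := cls _ c.
have hb : H2form h =2 b by move=> r s; rewrite H2form_cls.
have h_inv g : H2map (hat_act k A g) h = h.
  apply: (H2form_inj char0 (M := dual k (subg_of A))) => // r s.
  by rewrite (H2form_map _ _ mulC) !hb b_inv.
exists (exist _ h h_inv); split=> // -[h' h'_inv] /= h'b; apply: eq_exist.
apply: (H2form_inj char0 (M := dual k (subg_of A))) => // r s.
by rewrite hb h'b.
Qed.

(** The inflated class and the class in [x] have the same form, so [H2form_inj] identifies them.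
    This gives surjectivity onto the colimit. *)
Lemma colim_arrow_of_reduction (p : calB k G) (h : H2inv k (calB_group p))
    (x : {A : abnormal G & H2inv k A}) :
  H2form (sval h) =2 calB_form p ->
  is_reduction (H2form (sval (tagged x))) p ->
  colim_arrow (Tagged (@H2inv k G) h) x.
Proof.
case: x => A [y y_inv] hp [sBA /= yE]; exists sBA; apply: eq_exist => /=.
apply: (H2form_inj char0 (M := dual k (subg_of A))) => [|r s].
  exact: hat_mulC.
by rewrite (H2form_map _ _ (@hat_mulC A)) hp yE.
Qed.

Lemma is_reduction_id (p : calB k G) (h : H2inv k (calB_group p)) :
  H2form (sval h) =2 calB_form p -> is_reduction (H2form (sval h)) p.
Proof.
move=> hp; exists (subxx _) => r s; rewrite hp.
have resE (t : hat k (calB_group p)) : hat_res k (subxx (calB_group p)) t = t.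
  by apply: dual_eqP => a; rewrite ffunE; congr (t _); apply: val_inj.
by rewrite !resE.
Qed.

(** Restriction maps compose; with uniqueness, the reduction is constant on classes of the
    colimit. *)
Lemma is_reduction_arrow (x y : {A : abnormal G & H2inv k A}) (p : calB k G) :
  colim_arrow x y -> is_reduction (H2form (sval (tagged x))) p ->
  is_reduction (H2form (sval (tagged y))) p.
Proof.
case: x y => [A h] [B h'] [/= sAB <-] [sCA /= hE].
exists (subset_trans sCA sAB) => r s /=.
rewrite (H2form_map _ _ (@hat_mulC B)) hE.
by congr (calB_form p _ _); apply: dual_eqP => a; rewrite !ffunE;
   congr (dual_fun _ _); apply: val_inj.
Qed.

End AbelianNormalSubgroups.

Theorem proposition4p10 (k : closedFieldType) (char0 : [pchar k]%R =i pred0)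
    (G : finGroupType) :
  exists f : calB k G -> colimH2 k G,
    (forall p : calB k G,
       exists h : H2inv k (calB_group p),
         unique (fun h' : H2inv k (calB_group p) =>
                   H2form (sval h') =2 calB_form p) h /\
         f p = colim_in h) /\
    bijective f.
Proof.
pose h p := sval (cid (calB_class_exists char0 (G := G) p)).
have hP p := svalP (cid (calB_class_exists char0 (G := G) p)).
have hE p : H2form (sval (h p)) =2 calB_form p := (hP p).1.
have red_exists (x : {A : abnormal G & H2inv k A}) :
    exists p, is_reduction (H2form (sval (tagged x))) p.
  apply: (reduction_exists char0); first exact: H2form_alternating.
  exact: H2inv_form_invariant.
pose red x := sval (cid (red_exists x)).
have redP x : is_reduction (H2form (sval (tagged x))) (red x).
  exact: svalP (cid (red_exists x)).
have red_arrow x y : colim_arrow x y -> red x = red y.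
  move=> xy; apply: (is_reduction_unique char0 _ (redP y)).
  exact: is_reduction_arrow xy (redP x).
exists (fun p => colim_in (h p)); split=> [p|]; first by exists (h p).
(* The inverse reduces a representative; [red_arrow] makes the choice irrelevant, and a
   non-degenerate form is its own reduction. *)
exists (fun q => red (rep q)) => [p|q].
  rewrite (rep_cls red_arrow); apply: (is_reduction_unique char0 (redP _)).
  exact: is_reduction_id.
rewrite -[RHS]repK; apply/clsP/rst_step.
exact: colim_arrow_of_reduction (hE _) (redP _).
Qed.
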